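(* Any nontrivial amorphic $C$-algebra all of whose structure constants are integers is (up to isomorphism) a fusion of a generalized affine $C$-algebra.
   Context: $C$-algebra: a pair $\mathcal{A}=(A,\mathcal{R})$ where $A$ is a finite-dimensional associative algebra over $\mathbb{C}$ with unit $e$ and a semilinear involutive anti-automorphism $*$, and $\mathcal{R}$ is a linear basis of $A$ with structure constants defined by $r\cdot s=\sum_{t\in\mathcal{R}}c_{r,s}^t t$ ($r,s\in\mathcal{R}$), such that: (C1) $e\in\mathcal{R}$ and $r^*\in\mathcal{R}$ for all $r\in\mathcal{R}$; (C2) $c_{r,s}^t\in\mathbb{R}$ for all $r,s,t\in\mathcal{R}$; (C3) for all $r,s\in\mathcal{R}$, $c_{r,s}^e=d_r\delta_{r^*,s}$ where $d_r>0$ and $\delta$ is the Kronecker symbol; (C4) the linear functional on $A$ defined by $r\mapsto d_r$ ($r\in\mathcal{R}$) is a one-dimensional $*$-representation of $A$. The degree of $\mathcal{A}$ is $n(\mathcal{A})=\sum_{r\in\mathcal{R}}d_r$. The $C$-algebra is homogeneous if $d_r$ does not depend on $r\in\mathcal{R}\setminus\{e\}$. An isomorphism from $(A,\mathcal{R})$ to $(A',\mathcal{R}')$ is a $*$-algebra isomorphism $\varphi:A\to A'$ with $\varphi(\mathcal{R})=\mathcal{R}'$. Fusion: for a partition $\pi$ of $\mathcal{R}$ with $\{e\}\in\pi$, the $\pi$-fusion of $\mathcal{A}$ is the pair $\mathcal{A}_\pi=(A_\pi,\mathcal{R}_\pi)$ where $\mathcal{R}_\pi=\{\sum_{r\in R}r:\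 R\in\pi\}$ and $A_\pi$ is the linear span of $\mathcal{R}_\pi$; it is a $C$-algebra (with the inherited operations) iff $A_\pi$ is a $*$-subalgebra of $A$. Amorphic: $\mathcal{A}$ is amorphic if for every partition $\pi$ of $\mathcal{R}$ with $\{e\}\in\pi$ the $\pi$-fusion $\mathcal{A}_\pi$ is a $C$-algebra. An amorphic $C$-algebra is nontrivial if $|\mathcal{R}|\ge 4$. The algebra $\mathcal{A}_\varepsilon(\mathcal{R},D)$: let $D$ be a finite multiset of at least four positive real numbers with $1\in D$, and $\varepsilon\in\{-1,+1\}$. Let $\mathcal{R}$ be a finite set with a distinguished element $e$ and $r\mapsto d_r$ a bijection from $\mathcal{R}$ to the multiset $D$ with $d_e=1$. Let $A$ be the complex vector space with basis $\mathcal{R}$, and let $*$ be the semilinear map on $A$ fixing every element of $\mathcal{R}$. Put $n=\sum_{r\in\mathcal{R}}d_r$, $d'_r=n-1-d_r$, $\mathcal{R}^\#=\mathcal{R}\setminus\{e\}$. Define $c_{r,s}^t$ by: $c_{r,s}^e=d_r\delta_{r,s}$; for $r,s,t\in\mathcal{R}^\#$, $c_{r,s}^t=\frac{d_rd_s}{(\sqrt n+\varepsilon)^2}$ if $r,s,t$ are pairwise distinct, $c_{r,r}^t=\frac{d_r}{2}\bigl(1+\frac{d_r-d'_r}{(\sqrt n+\varepsilon)^2}\bigr)$ if $r\neq t$, and $c_{r,r}^r=-\frac{d'_r}{2}\bigl(1+\frac{d_r-d'_r}{(\sqrt n+\varepsilon)^2}\bigr)+d_r-1$; in all remaining cases by the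 equalities $d_tc_{r,s}^{t}=d_rc_{s,t}^{r}=d_sc_{t,r}^{s}$, which means $c_{e,r}^t=c_{r,e}^t=\delta_{r,t}$, and $c_{r,s}^r=c_{s,r}^r=\frac{d_s}{d_r}c_{r,r}^s$ for distinct $r,s\in\mathcal{R}^\#$. The multiplication on $A$ is the bilinear one with $r\cdot s=\sum_{t\in\mathcal{R}}c_{r,s}^tt$, and $\mathcal{A}_\varepsilon(\mathcal{R},D)=(A,\mathcal{R})$. (All algebras $\mathcal{A}_\varepsilon(\mathcal{R},D)$ are amorphic $C$-algebras.) $\mathcal{A}_\varepsilon(D)$ denotes the class of all $\mathcal{A}_\varepsilon(\mathcal{R},D)$ with fixed $\varepsilon$ and $D$, considered up to isomorphism. Generalized affine $C$-algebra: a homogeneous $C$-algebra $\mathcal{A}=(A,\mathcal{R})\in\mathcal{A}_\varepsilon(D)$, for some $\varepsilon\in\{-1,+1\}$ and $D$, whose common value $d=d_r$ ($r\in\mathcal{R}\setminus\{e\}$) satisfies $d=\sqrt{n(\mathcal{A})}+\varepsilon$ (with the same $\varepsilon$). *)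

(* Defs.v *)
From HB Require Import structures.
From mathcomp Require Import all_boot all_order all_algebra all_field.
From mathcomp Require Import reals complex.

Set Implicit Arguments.
Unset Strict Implicit.
Unset Printing Implicit Defensive.

Import Order.TTheory GRing.Theory Num.Theory.
Local Open Scope ring_scope.
Local Open Scope complex_scope.

(* A pair (A, R) together with the operation [*]; the axioms of a C-algebra   *)
(* are in [is_calgebra] below.  The algebra A is the subspace [space] of a    *)
(* finite-dimensional unital algebra [ambient] over the complex numbers, and  *)
(* R is given as a family [bas] indexed by [idx], with [eidx] the index of    *)
(* the unit.  An abstract algebra is the case [space = fullv]; the subspace   *)
(* lets a fusion, which lives inside the algebra being fused, inherit the     *)
(* operations literally.  [star] is only constrained on [space].              *)
Record calg_data (R : realType) := CalgData {
  ambient : falgType R[i];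
  star : ambient -> ambient;
  space : {vspace ambient};
  idx : finType;
  bas : idx -> ambient;
  eidx : idx
}.

Section Calgebra.
Variable R : realType.
Implicit Types X Y : calg_data R.

Definition coef X (t : idx X) (v : ambient X) : R[i] :=
  coord (codom_tuple (@bas R X)) (enum_rank t) v.

Definition struct_const X (r s t : idx X) : R[i] :=
  coef t (bas r * bas s).

(* d_r = c_{r,r^*}^e, which axiom (C3) makes a real number *)
Definition deg X (r : idx X) : R :=
  complex.Re (coef (eidx X) (bas r * star (bas r))).

Definition total_deg X : R := \sum_(r : idx X) deg r.

(* the linear functional on A with value d_r at r *)
Definition deg_functional X (v : ambient X) : R[i] :=
  \sum_(r : idx X) coef r v * (deg r)%:C.

Record is_calgebra X : Prop := IsCalgebra {
  calg_unit : 1 \in space X;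
  calg_mul : {in space X &, forall u v, u * v \in space X};
  calg_star : {in space X, forall u, star u \in space X};
  calg_star_semilinear : forall a : R[i],
    {in space X &, forall u v, star (a *: u + v) = a^* *: star u + star v};
  calg_starK : {in space X, involutive (@star R X)};
  calg_star_anti : {in space X &, forall u v, star (u * v) = star v * star u};
  calg_basis : basis_of (space X) (codom_tuple (@bas R X));
  calg_C1_unit : bas (eidx X) = 1;
  calg_C1_star : forall r : idx X, exists s : idx X, star (bas r) = bas s;
  calg_C2 : forall r s t : idx X, struct_const r s t \is Num.real;
  calg_C3_pos : forall r : idx X, 0 < deg r;
  calg_C3 : forall r s : idx X,
    struct_const r s (eidx X) = (deg r)%:C *+ (star (bas r) == bas s);
  calg_C4_unit : deg_functional (1 : ambient X) = 1;
  calg_C4_mul : {in space X &, forall u v,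
    deg_functional (u * v) = deg_functional u * deg_functional v};
  calg_C4_star : {in space X, forall u,
    deg_functional (star u) = (deg_functional u)^*}
}.

Definition homogeneous X : Prop :=
  forall r s : idx X, r != eidx X -> s != eidx X -> deg r = deg s.

(* A linear map from one algebra to the other is represented by a linear map  *)
(* of the ambient algebras, of which only the values on [space X] matter.     *)
Definition is_calg_iso X Y (phi : 'Hom(ambient X, ambient Y)) : Prop :=
  [/\ {in space X &, injective phi} /\ (phi @: space X)%VS = space Y,
      phi 1 = 1,
      {in space X &, forall u v, phi (u * v) = phi u * phi v},
      {in space X, forall u, phi (star u) = star (phi u)}
    & codom (fun r : idx X => phi (bas r)) =i codom (@bas R Y)].

Definition calg_isomorphic X Y : Prop :=
  exists phi : 'Hom(ambient X, ambient Y), is_calg_iso phi.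

(* The blocks of the partition P index the basis of the fusion. *)
Definition fusion_bas X (P : {set {set idx X}})
    (B : {B : {set idx X} | B \in P}) : ambient X :=
  \sum_(r in val B) bas r.

Definition fusion X (P : {set {set idx X}}) (eP : [set eidx X] \in P) :
    calg_data R :=
  {| ambient := ambient X;
     star := @star R X;
     space := <<codom (@fusion_bas X P)>>%VS;
     idx := {B : {set idx X} | B \in P};
     bas := @fusion_bas X P;
     eidx := exist _ [set eidx X] eP |}.

Definition amorphic X : Prop :=
  is_calgebra X /\
  forall (P : {set {set idx X}}) (eP : [set eidx X] \in P),
    partition P [set: idx X] -> is_calgebra (fusion eP).

Definition integral_constants X : Prop :=
  forall r s t : idx X, exists z : int, struct_const r s t = z%:~R.

Section AepsConst.
Variables (eps : R) (I : finType) (e : I) (d : I -> R).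

Let n : R := \sum_r d r.
Let q : R := (Num.sqrt n + eps) ^+ 2.
Let d' (r : I) : R := n - 1 - d r.

(* c_{r,r}^t, for r and t distinct and different from e *)
Definition Aeps_rrt (r : I) : R := d r / 2 * (1 + (d r - d' r) / q).

Definition Aeps_rrr (r : I) : R :=
  - (d' r / 2) * (1 + (d r - d' r) / q) + d r - 1.

(* The structure constants of A_eps(R, D).  The branches t = r and t = s, for *)
(* r and s distinct, are c_{r,s}^r = c_{s,r}^r = (d_s / d_r) c_{r,r}^s.       *)
Definition Aeps_const (r s t : I) : R :=
  if t == e then d r *+ (r == s)
  else if r == e then (s == t)%:R
  else if s == e then (r == t)%:R
  else if r == s then (if r == t then Aeps_rrr r else Aeps_rrt r)
  else if t == r then d s / d r * Aeps_rrt r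
  else if t == s then d r / d s * Aeps_rrt s
  else d r * d s / q.

End AepsConst.

(* The finite multiset D is given by a sequence, considered up to             *)
(* permutation.                                                               *)
Definition admissible (D : seq R) : Prop :=
  [/\ (4 <= size D)%N, all (fun x => 0 < x) D & 1 \in D].

(* X is, up to isomorphism, the algebra A_eps(idx X, D) for the bijection     *)
(* d between idx X and the multiset D: [bas] is a basis consisting of fixed   *)
(* points of [star], on which the product is given by [Aeps_const].           *)
Definition in_Aeps (eps : R) (D : seq R) X : Prop :=
  is_calgebra X /\
  exists d : idx X -> R,
    [/\ perm_eq (codom d) D,
        d (eidx X) = 1,
        forall r : idx X, star (bas r) = bas r
      & forall r s t : idx X,
          struct_const r s t = (Aeps_const eps (eidx X) d r s t)%:C].

Definition generalized_affine X : Prop :=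
  [/\ is_calgebra X, homogeneous X
    & exists (eps : R) (D : seq R),
        [/\ eps = 1 \/ eps = -1, admissible D, in_Aeps eps D X
          & forall r : idx X, r != eidx X ->
              deg r = Num.sqrt (total_deg X) + eps]].

End Calgebra.

(* Main.v *)
From HB Require Import structures.
Require Import Defs.
From mathcomp Require Import all_boot all_order all_algebra all_field.
From mathcomp Require Import reals complex.
From mathcomp Require Import ring lra zify.

Set Implicit Arguments.
Unset Strict Implicit.
Unset Printing Implicit Defensive.

Import Order.TTheory GRing.Theory Num.Theory.
Local Open Scope ring_scope.
Local Open Scope complex_scope.

(** Amorphicity is so strong a symmetry that it determines the structure
constants from the degrees.  Fusing everything outside a set A of basis
elements containing e shows that, for r and s in A, the constant c_{rs}^t is
the same for all t outside A ([amorphic_const]), and that the involution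
fixes every basis element ([amorphic_star]), so the algebra is commutative.
Together with the symmetry of d_t c_{rs}^t in r, s, t this gives
c_{rs}^t = lam d_r d_s for r, s, t distinct and different from e.  The degree
functional then yields c_{rr}^t = d_r (beta + lam d_r), where
beta = (1 - lam N) / 2 and N is the sum of the degrees other than d_e, and
one instance of associativity forces beta ^ 2 = lam ([beta_sq]).

Let eps be the sign of beta, x = 1 / |beta| and k_r = d_r / x.  For r, s, t
different from e the constants become
  c_{rs}^t = k_r k_s + eps ([t = r] k_s + [t = s] k_r + [r = s] k_r)
             + (1 - eps x) [r = s = t],
and the sum of the k_r over r different from e is x - 2 eps
([amorphic_classification]). Here x is sqrt n + eps, so a generalized affine
algebra is the case where every k_r is 1, and k_r is the number of its basis
elements that should be merged into r. If the constants are integers, then so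
are, for r, s, t distinct, c_{rs}^t = k_r k_s and c_{rs}^s = k_r k_s + eps
k_r, hence k_r is an integer ([integral_multiplicities]).

It remains to produce the generalized affine algebra and to fuse it. The
algebra is given by its characters: the function with value x k_r at r, and
for each j different from e the function with value eps k_r + (1 - eps x) [r =
j] at r, all with value 1 at e, are multiplicative for the constants above
([scaled_charM]). When all k_r are 1 these characters are enough to make the
basis free, and reading them off as diagonal entries realizes the algebra
inside a matrix algebra ([affine_calgP]). Index its basis by the pairs (r, i)
with r different from e and i < k_r, together with e. Adding the characters
over the fibre of r gives eps k_r + (1 - eps x) [r = j], the character table
of the algebra one started from, so the fibre sums multiply as the given basis
does ([fibre_sumM]), and the fusion along the fibres is the required one. *)

(** * Structure constants and characters in terms of multiplicities *)

Section Scaled.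
Variables (R : realFieldType) (I : finType) (e : I) (eps x : R) (k : I -> R).

(** The structure constants of an amorphic algebra with degrees x * k r: a
product with rank one main term, corrected where two or three of the indices
coincide. *)
Definition scaled_const (r s t : I) : R :=
  if r == e then (s == t)%:R
  else if s == e then (r == t)%:R
  else if t == e then (x * k r) *+ (r == s)
  else k r * k s + eps * (k s *+ (t == r) + k r *+ (t == s) + k r *+ (r == s))
       + (1 - eps * x) *+ ((r == s) && (s == t)).

(** The character table of the algebra with structure constants
[scaled_const], with one character for each basis element; the one of index e
is the degree. *)
Definition scaled_char (j r : I) : R :=
  if r == e then 1 else if j == e then x * k r
  else eps * k r + (1 - eps * x) *+ (r == j).

Hypothesis eps2 : eps * eps = 1.
Hypothesis sum_k : \sum_(r | r != e) k r = x - 2 * eps.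

Lemma sum_delta (P : pred I) (F : I -> R) (r : I) :
  P r -> \sum_(t | P t) F t *+ (t == r) = F r.
Proof.
move=> Pr; rewrite (bigD1 r) //= eqxx big1 ?addr0 // => t /andP[_ /negPf->].
by rewrite mulr0n.
Qed.

(** Each term of the table is constant in t or supported at t = r or t = s, so
the sum only involves the total of f and its values at r and s. *)
Lemma sum_scaled_const (r s : I) (f : I -> R) : r != e -> s != e ->
  \sum_(t | t != e) scaled_const r s t * f t =
    (k r * k s + eps * k r *+ (r == s)) * (\sum_(t | t != e) f t)
    + eps * (k s * f r + k r * f s) + ((1 - eps * x) * f s) *+ (r == s).
Proof.
move=> rn sn.
rewrite (eq_bigr (fun t => (k r * k s + eps * k r *+ (r == s)) * f t
   + ((eps * k s) * f t *+ (t == r) + ((eps * k r) * f t *+ (t == s)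
   + ((1 - eps * x) *+ (r == s)) * f t *+ (t == s))))).
  rewrite !big_split /= -mulr_sumr !sum_delta //.
  by case: (r == s); rewrite /= ?mulr1n ?mulr0n; ring.
move=> t tn; rewrite /scaled_const (negPf rn) (negPf sn) (negPf tn).
rewrite (eq_sym s t); case: (r == s); case: (t == r); case: (t == s);
  by rewrite /= ?mulr1n ?mulr0n; ring.
Qed.

(** By [sum_scaled_const] this reduces to polynomial identities in eps, x and
the values of k, given the total of the character, which follows from
[sum_k]. *)
Lemma scaled_charM (j r s : I) :
  scaled_char j r * scaled_char j s =
  \sum_t scaled_const r s t * scaled_char j t.
Proof.
have [->|rn] := eqVneq r e.
  rewrite {1}/scaled_char eqxx mul1r.
  rewrite -(sum_delta (scaled_char j) (P := predT) (r := s)) //.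
  apply: eq_bigr => t _; rewrite /scaled_const eqxx eq_sym mulr_natl.
  by case: (s == t).
have [->|sn] := eqVneq s e.
  rewrite {2}/scaled_char eqxx mulr1.
  rewrite -(sum_delta (scaled_char j) (P := predT) (r := r)) //.
  apply: eq_bigr => t _; rewrite /scaled_const (negPf rn) eqxx eq_sym.
  by case: (r == t); rewrite /= ?mul1r ?mul0r.
rewrite (bigD1 e) //= sum_scaled_const //.
rewrite /scaled_const (negPf rn) (negPf sn) eqxx /scaled_char eqxx (negPf rn).
rewrite (negPf sn).
have [_|jn] := eqVneq j e.
  rewrite (eq_bigr (fun t => x * k t)); last by move=> t /negPf->.
  rewrite -mulr_sumr sum_k.
  have [<-|_] := eqVneq r s; rewrite /= ?mulr1n ?mulr0n.
    by ring: eps2.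
  by ring: eps2.
rewrite (eq_bigr (fun t => eps * k t + (1 - eps * x) *+ (t == j))); last first.
  by move=> t /negPf->.
rewrite big_split /= -mulr_sumr sum_k (sum_delta (fun=> _)) //.
have [<-|rs] := eqVneq r s; last have [rj|rj] := eqVneq r j.
- by case: (r == j); rewrite ?mulr1n ?mulr0n; ring: eps2.
- by rewrite -rj (eq_sym s) (negPf rs) ?mulr1n ?mulr0n; ring: eps2.
- by case: (s == j); rewrite ?mulr1n ?mulr0n; ring: eps2.
Qed.

End Scaled.

Section Aeps.
Variables (R : realType) (I : finType) (e : I) (eps x : R) (k : I -> R).
Hypothesis eps_pm : eps = 1 \/ eps = -1.
Hypothesis x_gt0 : 0 < x.
Hypothesis k_gt0 : forall r, 0 < k r.
Hypothesis sum_k : \sum_(r | r != e) k r = x - 2 * eps.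

Let d r := if r == e then 1 else x * k r.

Lemma sum_deg_scaled : \sum_r d r = (x - eps) ^+ 2.
Proof.
rewrite (bigD1 e) //= {1}/d eqxx (eq_bigr (fun r => x * k r)).
  by rewrite -mulr_sumr sum_k; case: eps_pm => ->; ring.
by move=> r /negPf rn; rewrite /d rn.
Qed.

(** The total degree is the square of x - eps, which is nonnegative because
x - 2 eps is a sum of positive numbers. *)
Lemma sqrt_total_scaled : Num.sqrt (\sum_r d r) + eps = x.
Proof.
rewrite sum_deg_scaled sqrtr_sqr ger0_norm ?subrK //.
have : 0 <= x - 2 * eps by rewrite -sum_k; apply: sumr_ge0 => r _; apply: ltW.
by case: eps_pm => -> h; [lra | rewrite opprK addr_ge0 ?ltW].
Qed.

Lemma Aeps_const_scaled r s t :
  Aeps_const eps e d r s t = scaled_const e eps x k r s t.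
Proof.
rewrite /Aeps_const /scaled_const /Aeps_rrr /Aeps_rrt sqrt_total_scaled.
rewrite sum_deg_scaled.
have xn : x != 0 by rewrite gt_eqF.
have kn u : k u != 0 by rewrite gt_eqF.
have [->|tn] := eqVneq t e.
  have [->|rn] := eqVneq r e; first by rewrite /d eqxx eq_sym.
  have [->|sn] := eqVneq s e; first by rewrite (negPf rn).
  by rewrite /d (negPf rn).
have [_|rn] := eqVneq r e; first by [].
have [_|sn] := eqVneq s e; first by [].
rewrite /d (negPf rn) (negPf sn) (eq_sym s t).
have [<-|rs] := eqVneq r s.
  rewrite (eq_sym r t); have [_|_] := eqVneq t r; rewrite /= ?mulr1n ?mulr0n.
    by case: eps_pm => ->; field.
  by case: eps_pm => ->; field.
have [tr|tr] := eqVneq t r.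
  rewrite tr (negPf rs) ?mulr1n ?mulr0n.
  by case: eps_pm => ->; field; rewrite kn xn.
have [_|_] := eqVneq t s; rewrite ?mulr1n ?mulr0n.
  by case: eps_pm => ->; field; rewrite kn xn.
by case: eps_pm => ->; field.
Qed.

End Aeps.

(** * The structure constants forced by constancy outside the indices *)

Lemma exists_notin (I : finType) (s : seq I) :
  (size s < #|I|)%N -> exists t, t \notin s.
Proof.
move=> small; case: (pickP [predC s]) => [t tn|all_s]; first by exists t.
suff: (#|I| <= size s)%N by rewrite leqNgt small.
apply: leq_trans (card_size s); apply/subset_leq_card/subsetP => t _.
by have := all_s t; rewrite /= => /negbFE.
Qed.

Section Classification.
Variables (R : realFieldType) (I : finType) (e : I).
Variables (d : I -> R) (c : I -> I -> I -> R).

Hypothesis card_I : (4 <= #|I|)%N.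
Hypothesis d_gt0 : forall r, 0 < d r.
Hypothesis d_e : d e = 1.
Hypothesis c1r : forall r t, c e r t = (r == t)%:R.
Hypothesis c_e : forall r s, c r s e = d r *+ (r == s).
Hypothesis cC : forall r s t, c r s t = c s r t.
Hypothesis c_cyc : forall r s t, d t * c r s t = d r * c s t r.
Hypothesis c_deg : forall r s, \sum_t c r s t * d t = d r * d s.
Hypothesis cA : forall r s t v,
  \sum_u c r s u * c u t v = \sum_u c s t u * c r u v.
Hypothesis c_const : forall r s t t', t \notin [:: e; r; s] ->
  t' \notin [:: e; r; s] -> c r s t = c r s t'.

Let N : R := \sum_(r | r != e) d r.
Let d_neq0 r : d r != 0. Proof. by rewrite gt_eqF. Qed.

Let ratio r s t := c r s t / (d r * d s).

Let ratioC r s t : ratio r s t = ratio s r t.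
Proof. by rewrite /ratio cC (mulrC (d r)). Qed.

Let ratio_cyc r s t : ratio r s t = ratio s t r.
Proof.
apply/eqP; rewrite eqr_div ?mulf_neq0 // -subr_eq0.
have := c_cyc r s t => h; apply/eqP.
transitivity (d s * (d t * c r s t - d r * c s t r)); first by ring.
by rewrite h subrr mulr0.
Qed.

Let distinct3 r s t :=
  [/\ r <> e, s <> e & t <> e] /\ [/\ r <> s, s <> t & r <> t].

Let ratio_const r s t t' : distinct3 r s t -> distinct3 r s t' ->
  ratio r s t = ratio r s t'.
Proof.
move=> [[? ? ?] [? ? ?]] [[_ _ ?] [_ ? ?]].
rewrite /ratio (@c_const r s t t') //;
  by rewrite !inE !negb_or; apply/and3P; split; apply/eqP; congruence.
Qed.

Let ratio_move r s t a : distinct3 r s t -> a <> e ->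
  exists s' t', distinct3 a s' t' /\ ratio r s t = ratio a s' t'.
Proof.
move=> rst an; have [[? ? ?] [? ? ?]] := rst.
have [->|/eqP ar] := eqVneq a r; first by exists s, t.
have [->|/eqP as_] := eqVneq a s.
  by exists t, r; split; [split; split; congruence | rewrite ratio_cyc].
have [->|/eqP at_] := eqVneq a t.
  by exists r, s; split; [split; split; congruence | rewrite 2!ratio_cyc].
exists s, t; split; first by split; split; congruence.
rewrite (ratio_cyc r) (ratio_cyc a).
by apply: ratio_const; split; split; congruence.
Qed.

Let ratio_move2 r s t b : distinct3 r s t -> b <> e -> b <> r ->
  exists t', distinct3 r b t' /\ ratio r s t = ratio r b t'.
Proof.
move=> rst bn br; have [[? ? ?] [? ? ?]] := rst.
have [->|/eqP bs] := eqVneq b s; first by exists t.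
have [->|/eqP bt] := eqVneq b t.
  exists s; split; first by split; split; congruence.
  by rewrite (ratio_cyc r) ratioC -(ratio_cyc r).
exists t; split; first by split; split; congruence.
rewrite -(ratio_cyc t) -(ratio_cyc t).
by apply: ratio_const; split; split; congruence.
Qed.

(** Any triple of distinct indices is reached from any other by replacing one
index at a time, the ratio being symmetric and unchanged at each step. *)
Let ratio_eq r s t r' s' t' : distinct3 r s t -> distinct3 r' s' t' ->
  ratio r s t = ratio r' s' t'.
Proof.
move=> rst rst'; have [[r'n s'n t'n] [rs' st' rt']] := rst'.
have [s1 [t1 [rst1 ->]]] := ratio_move rst r'n.
have [t2 [rst2 ->]] := ratio_move2 rst1 s'n (not_eq_sym rs').
exact: ratio_const.
Qed.

Let exists_triple : exists r s t, distinct3 r s t.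
Proof.
have [|r] := @exists_notin I [:: e]; first exact: leq_trans card_I.
rewrite !inE => /eqP ?.
have [|s] := @exists_notin I [:: e; r]; first exact: leq_trans card_I.
rewrite !inE !negb_or => /andP[/eqP ? /eqP ?].
have [|t] := @exists_notin I [:: e; r; s]; first exact: card_I.
rewrite !inE !negb_or => /and3P[/eqP ? /eqP ? /eqP ?].
by exists r, s, t; split; split; congruence.
Qed.

Let exists_third r s : r <> e -> s <> e -> r <> s -> exists t, distinct3 r s t.
Proof.
move=> ? ? ?; have [|t] := @exists_notin I [:: e; r; s]; first exact: card_I.
rewrite !inE !negb_or => /and3P[/eqP ? /eqP ? /eqP ?].
by exists t; split; split; congruence.
Qed.

Lemma distinct_const :
  exists lam, forall r s t, distinct3 r s t -> c r s t = lam * (d r * d s).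
Proof.
have [r0 [s0 [t0 D0]]] := exists_triple; exists (ratio r0 s0 t0) => r s t Drst.
by rewrite -(ratio_eq Drst D0) /ratio divfK ?mulf_neq0.
Qed.

Let c_rsr r s : c r s r = d s * c r r s / d r.
Proof. by rewrite c_cyc mulrAC divff ?mul1r // cC. Qed.

Let c_rss r s : c r s s = d r * c s s r / d s.
Proof. by rewrite cC c_rsr. Qed.

Section Lambda.
Variable lam : R.
Hypothesis c_rst : forall r s t, distinct3 r s t -> c r s t = lam * (d r * d s).
Let beta := (1 - lam * N) / 2.

Let sum_distinct3 (F : I -> R) r s t : distinct3 r s t ->
  \sum_u F u = F e + F r + F s + F t + \sum_(u | u \notin [:: e; r; s; t]) F u.
Proof.
move=> [[/eqP rn /eqP sn /eqP tn] [/eqP rs /eqP st /eqP rt]].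
rewrite (bigD1 e) //= (bigD1 r) //= (bigD1 s) /=; last by rewrite sn eq_sym.
rewrite (bigD1 t) /=; last by rewrite tn eq_sym rt eq_sym.
rewrite !addrA; congr (_ + _); apply: eq_bigl => u.
by rewrite !inE !negb_or -!andbA.
Qed.

Let sum_others r s t : distinct3 r s t ->
  \sum_(u | u \notin [:: e; r; s; t]) d u = N - d r - d s - d t.
Proof.
move=> rst; have := sum_distinct3 d rst; rewrite (bigD1 e) //= -/N => h.
by apply: (addrI (d e + d r + d s + d t)); rewrite -h; ring.
Qed.

Let distinct3_others r s t u : distinct3 r s t -> u \notin [:: e; r; s; t] ->
  [/\ distinct3 r s u, distinct3 s t u & distinct3 r t u].
Proof.
move=> [[? ? ?] [? ? ?]]; rewrite !inE !negb_or.
move=> /and4P[/eqP ? /eqP ? /eqP ? /eqP ?].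
by split; split; split; congruence.
Qed.

Let c_rr_const r s t : distinct3 r s t -> c r r s = c r r t.
Proof.
move=> [[? ? ?] [? ? ?]]; apply: c_const;
  by rewrite !inE !negb_or; apply/and3P; split; apply/eqP; congruence.
Qed.

(** This is the multiplicativity of the degree functional at (r, s), divided by
d_r d_s. *)
Let pair_eq r s t : distinct3 r s t ->
  c r r t / d r + c s s t / d s + lam * (N - d r - d s) = 1.
Proof.
move=> rst; have [[? ? ?] [rs ? ?]] := rst.
have /eqP/negPf rsF := rs.
have := c_deg r s; rewrite (sum_distinct3 _ rst) c_e rsF mulr0n mul0r add0r.
rewrite c_rsr c_rss (c_rst rst).
rewrite (eq_bigr (fun u => lam * (d r * d s) * d u)); last first.
  by move=> u /(distinct3_others rst)[/c_rst-> _ _].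
rewrite -mulr_sumr (sum_others rst).
rewrite (@c_rr_const r s t) // (@c_rr_const s r t); last first.
  by split; split; congruence.
move=> h; apply: (mulfI (mulf_neq0 (d_neq0 r) (d_neq0 s))).
by rewrite mulr1 -[RHS]h; field; rewrite !d_neq0.
Qed.

(** With a third index s, the equations [pair_eq] for the three pairs taken from
r, s, t form an invertible linear system in the ratios c_{uu}^v / d_u. *)
Lemma c_rrt r t : r <> e -> t <> e -> r <> t ->
  c r r t = d r * (beta + lam * d r).
Proof.
move=> rn tn rt; have [s [[_ _ sn] [_ ts rs]]] := exists_third rn tn rt.
have h1 : c r r t / d r + c s s t / d s + lam * (N - d r - d s) = 1.
  by apply: pair_eq; split; split; congruence.
have h2 : c r r s / d r + c t t s / d t + lam * (N - d r - d t) = 1.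
  by apply: pair_eq; split; split; congruence.
have h3 : c t t r / d t + c s s r / d s + lam * (N - d t - d s) = 1.
  by apply: pair_eq; split; split; congruence.
have e1 : c r r s = c r r t by apply: c_rr_const; split; split; congruence.
have e2 : c s s r = c s s t by apply: c_rr_const; split; split; congruence.
have e3 : c t t r = c t t s by apply: c_rr_const; split; split; congruence.
rewrite e1 in h2; rewrite e2 e3 in h3.
have -> : c r r t = d r * (c r r t / d r) by rewrite mulrCA divff ?mulr1.
by congr (_ * _); rewrite /beta; lra.
Qed.

Lemma c_rrr r : r <> e ->
  c r r r = d r - 1 - (beta + lam * d r) * (N - d r).
Proof.
move=> /eqP rn; have := c_deg r r; rewrite (bigD1 e) //= (bigD1 r) //=.
rewrite (eq_bigr (fun u => d r * (beta + lam * d r) * d u)); last first.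
  move=> u /andP[/eqP un /eqP ur]; rewrite c_rrt //; first exact/eqP.
  by congruence.
rewrite -mulr_sumr.
have -> : \sum_(u | (u != e) && (u != r)) d u = N - d r.
  by rewrite /N [in RHS](bigD1 r) //= addrAC subrr add0r.
rewrite c_e eqxx mulr1n d_e mulr1 => h.
apply: (mulIf (d_neq0 r)); move: h; lra.
Qed.

(** Comparing the coefficients of t in (r r) s and r (r s), for r, s, t
distinct, all other terms cancel and leave beta ^ 2 - lam, up to the factor
d_r d_s. *)
Lemma beta_sq : beta ^+ 2 = lam.
Proof.
have [r [s [t rst]]] := exists_triple; have [[rn sn tn] [rs st rt]] := rst.
have := cA r r s t; rewrite !(sum_distinct3 _ rst) !c_e c1r.
have /eqP/negPf-> := rs; have /eqP/negPf-> := st.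
rewrite eqxx !mulr0n mulr1n !mulr0 !mul0r !add0r.
rewrite (eq_bigr (fun u => d r * (beta + lam * d r) * (lam * d s) * d u)).
  rewrite [in RHS](eq_bigr (fun u => lam * (d r * d s) * (lam * d r) * d u)).
    rewrite -!mulr_sumr (sum_others rst).
    rewrite (c_rsr t s) (c_rss r t) (c_rsr r s) (c_rss r s) (c_rst rst).
    rewrite c_rrr // !c_rrt //; try congruence.
    move=> /eqP; rewrite -subr_eq0 => /eqP h.
    apply/eqP; rewrite -subr_eq0; apply/eqP.
    apply: (mulfI (mulf_neq0 (d_neq0 r) (d_neq0 s))); rewrite mulr0 -[RHS]h.
    by rewrite /beta; field; rewrite !d_neq0.
  move=> u /(distinct3_others rst)[Drsu Dstu Drtu].
  rewrite (c_rst Drsu) c_rst; first by ring.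
  by case: Drtu => [[? ? ?] [? ? ?]]; split; split; congruence.
move=> u un; have [Drsu Dstu Drtu] := distinct3_others rst un.
rewrite c_rrt //; try by case: Drtu => [[? ? ?] [? ? ?]]; congruence.
rewrite c_rst; first by ring.
by case: Dstu => [[? ? ?] [? ? ?]]; split; split; congruence.
Qed.

End Lambda.

(** Since beta = eps / x, the relations beta ^ 2 = lam and 1 - lam N = 2 beta
become lam = 1 / x ^ 2 and N = x (x - 2 eps). *)
Theorem forced_constants : exists (eps x : R), [/\ eps = 1 \/ eps = -1, 0 < x,
  \sum_(r | r != e) d r / x = x - 2 * eps
  & forall r s t, c r s t = scaled_const e eps x (fun r => d r / x) r s t].
Proof.
have [lam c_rst] := distinct_const.
have := beta_sq c_rst; have := c_rrt c_rst; have := c_rrr c_rst.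
have : 1 - lam * N = 2 * ((1 - lam * N) / 2) by field.
set beta := (1 - lam * N) / 2 => h c_rrr' c_rrt' beta2.
rewrite -{}beta2 in c_rrr' c_rrt' c_rst h.
have beta0 : beta != 0.
  apply/eqP => b0; move: h; rewrite b0 expr0n mul0r subr0 mulr0 => /eqP.
  by rewrite oner_eq0.
have [eps [x [eps_pm x_gt0 betaE]]] : exists eps x : R,
    [/\ eps = 1 \/ eps = -1, 0 < x & beta = eps / x].
  exists (Num.sg beta), (`|beta|^-1); split.
  - by have [b|b|b] := sgrP beta; [rewrite b eqxx in beta0|left|right].
  - by rewrite invr_gt0 normr_gt0.
  - by rewrite invrK -numEsg.
have x0 : x != 0 by rewrite gt_eqF.
move: h c_rrr' c_rrt' c_rst; rewrite {}betaE => h c_rrr' c_rrt' c_rst.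
exists eps, x; split=> //.
  rewrite -mulr_suml -/N.
  have -> : N = x ^+ 2 * (1 - 2 * (eps / x)).
    by rewrite -h; case: eps_pm => ->; field.
  by field.
move=> r s t; rewrite /scaled_const.
have [->|/eqP rn] := eqVneq r e; first by rewrite c1r.
have [->|/eqP sn] := eqVneq s e; first by rewrite cC c1r.
have [->|/eqP tn] := eqVneq t e.
  by rewrite c_e mulrCA divff ?mulr1.
rewrite (eq_sym s t); have [<-|/eqP rs] := eqVneq r s.
  have [->|/eqP tr] := eqVneq t r.
    rewrite c_rrr' //= !mulr1n; case: eps_pm h => -> h.
      have -> : N = x ^+ 2 * (1 - 2 * (1 / x)) by rewrite -h; field.
      by field.
    have -> : N = x ^+ 2 * (1 - 2 * (-1 / x)) by rewrite -h; field.
    by field.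
  rewrite c_rrt' //= ?mulr1n ?mulr0n; last by congruence.
  by case: eps_pm => ->; field.
have [->|/eqP tr] := eqVneq t r.
  rewrite c_rsr c_rrt' ?mulr1n //.
  have /eqP/negPf-> := rs; rewrite /= !mulr0n.
  by case: eps_pm => ->; field; rewrite x0 d_neq0.
have [->|/eqP ts] := eqVneq t s.
  rewrite c_rss c_rrt' /= ?mulr1n ?mulr0n //; last by congruence.
  by case: eps_pm => ->; field; rewrite x0 d_neq0.
rewrite c_rst ?mulr0n; last by split; split; congruence.
by case: eps_pm => ->; field.
Qed.

End Classification.

(** * Coordinates in a family indexed by a finite type *)

Section CodomCoord.
Variables (K : fieldType) (vT : vectType K) (J : finType) (b : J -> vT).

Lemma sum_codom_tuple (a : 'I_#|J| -> K) :
  \sum_i a i *: (codom_tuple b)`_i = \sum_t a (enum_rank t) *: b t.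
Proof.
rewrite (reindex (@enum_rank J)); last exact/onW_bij/enum_rank_bij.
by apply: eq_bigr => t _; rewrite nth_codom enum_rankK.
Qed.

Lemma free_codomP :
  (forall a : J -> K, \sum_t a t *: b t = 0 -> forall t, a t = 0) ->
  free (codom_tuple b).
Proof.
move=> indep; apply/(@freeP _ _ _ (codom_tuple b)) => a.
rewrite sum_codom_tuple => a0 i.
by rewrite -(enum_valK i) (indep (fun t => a (enum_rank t))).
Qed.

Lemma coord_codom_sum (a : J -> K) t : free (codom_tuple b) ->
  coord (codom_tuple b) (enum_rank t) (\sum_r a r *: b r) = a t.
Proof.
move=> fb; rewrite (eq_bigr (fun r => a (enum_val (enum_rank r)) *: b r)).
  rewrite -(sum_codom_tuple (fun i => a (enum_val i))).
  by rewrite coord_sum_free ?enum_rankK.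
by move=> r _; rewrite enum_rankK.
Qed.

Lemma coord_codom t r : free (codom_tuple b) ->
  coord (codom_tuple b) (enum_rank t) (b r) = (r == t)%:R.
Proof.
move=> fb; rewrite -(coord_codom_sum (fun u => (r == u)%:R)) // (bigD1 r) //=.
rewrite eqxx scale1r big1 ?addr0 // => v.
by rewrite eq_sym => /negPf->; rewrite scale0r.
Qed.

Lemma free_codom_inj : free (codom_tuple b) -> injective b.
Proof.
move=> fb r s eq_b; have := coord_codom s r fb.
rewrite eq_b coord_codom // eqxx.
by case: eqP => // _ /eqP; rewrite oner_eq0.
Qed.

Lemma coord_codom_span v : v \in <<codom_tuple b>>%VS ->
  v = \sum_t coord (codom_tuple b) (enum_rank t) v *: b t.
Proof. by move/coord_span => {1}->; rewrite sum_codom_tuple. Qed.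

End CodomCoord.

(** * Real structure constants and the involution *)

Section CalgTheory.
Variables (R : realType) (X : calg_data R).
Hypothesis X_calg : is_calgebra X.

Let free_bas := basis_free (calg_basis X_calg).

Lemma space_span : Defs.space X = <<codom_tuple (@bas R X)>>%VS.
Proof. by rewrite (span_basis (calg_basis X_calg)). Qed.

Lemma coef_expand v : v \in Defs.space X -> v = \sum_t coef t v *: bas t.
Proof. by rewrite space_span => /coord_codom_span. Qed.

Lemma bas_space (r : idx X) : bas r \in Defs.space X.
Proof. by rewrite space_span memv_span ?codom_f. Qed.

Lemma coef_bas (t r : idx X) : coef t (bas r) = (r == t)%:R.
Proof. exact: coord_codom. Qed.

Lemma coefD t (u v : ambient X) : coef t (u + v) = coef t u + coef t v.
Proof. exact: linearD. Qed.

Lemma coefZ t a (v : ambient X) : coef t (a *: v) = a * coef t v.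
Proof. exact: linearZ. Qed.

Lemma coef_big (I : Type) (s : seq I) (P : pred I) t (F : I -> ambient X) :
  coef t (\sum_(i <- s | P i) F i) = \sum_(i <- s | P i) coef t (F i).
Proof. exact: linear_sum. Qed.

Lemma bas_inj : injective (@bas R X).
Proof. exact: free_codom_inj. Qed.

Definition rconst (r s t : idx X) : R := complex.Re (struct_const r s t).

Lemma struct_constE r s t : struct_const r s t = (rconst r s t)%:C.
Proof. by rewrite RRe_real // (calg_C2 X_calg). Qed.

Lemma bas_mul (r s : idx X) :
  bas r * bas s = \sum_t (rconst r s t)%:C *: bas t.
Proof.
rewrite {1}(coef_expand (calg_mul X_calg (bas_space r) (bas_space s))).
by apply: eq_bigr => t _; rewrite -struct_constE.
Qed.

Lemma star0 : star (0 : ambient X) = 0.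
Proof.
have := calg_star_semilinear X_calg 1 (mem0v _) (mem0v _).
rewrite scaler0 addr0 rmorph1 scale1r => /eqP.
by rewrite eq_sym -subr_eq0 addrK => /eqP.
Qed.

Lemma star_sum (I : finType) (a : I -> R[i]) (v : I -> ambient X) :
  (forall r, v r \in Defs.space X) ->
  star (\sum_r a r *: v r) = \sum_r ((a r)^*)%R *: star (v r).
Proof.
move=> v_in; suff [] : \sum_r a r *: v r \in Defs.space X /\
  star (\sum_r a r *: v r) = \sum_r ((a r)^*)%R *: star (v r) by [].
elim/big_rec2: _ => [|r w u _ [u_in <-]]; first by rewrite mem0v star0.
split; first by rewrite memvD ?memvZ.
by rewrite (calg_star_semilinear X_calg).
Qed.

Lemma star1 : star (1 : ambient X) = 1.
Proof.
have u := calg_unit X_calg; have su := calg_star X_calg u.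
have := calg_star_anti X_calg su u.
by rewrite mulr1 (calg_starK X_calg u) mulr1 => <-.
Qed.

End CalgTheory.

(** * Constancy of coordinates in a fusion *)

Section Fusion.
Variables (R : realType) (X : calg_data R).
Hypothesis X_calg : is_calgebra X.

Lemma fusion_coef_const (P : {set {set idx X}}) (B : {set idx X}) t t' v :
  trivIset P -> B \in P -> t \in B -> t' \in B ->
  v \in <<codom (@fusion_bas R X P)>>%VS -> coef t v = coef t' v.
Proof.
move=> tP BP tB t'B /(@coord_codom_span _ _ _ (@fusion_bas R X P))->.
rewrite !coef_big; apply: eq_bigr => C _; rewrite !coefZ; congr (_ * _).
rewrite /fusion_bas !coef_big.
have coefC u : u \in B -> \sum_(r in val C) coef u (bas r) = (B == val C)%:R.
  move=> uB; case: eqVneq => [BC|BC].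
    rewrite (bigD1 u) -?BC //= coef_bas // eqxx big1 ?addr0 // => r.
    by case/andP=> _ /negPf; rewrite coef_bas // => ->.
  rewrite big1 // => r rC; rewrite coef_bas //; case: eqP => // ru.
  have := trivIsetP tP _ _ BP (valP C) BC.
  by move=> /disjointFr/(_ uB); rewrite -ru rC.
by rewrite !coefC.
Qed.

Variable A : {set idx X}.
Hypothesis eA : eidx X \in A.

(** The coarsest partition in which each element of A is a block; the coarser
the fusion, the more coordinates it forces to be equal. *)
Definition singletons_partition : {set {set idx X}} :=
  preim_partition (fun t => if t \in A then Some t else None) [set: idx X].

Lemma singletons_partitionP : partition singletons_partition [set: idx X].
Proof. exact: preim_partitionP. Qed.

Lemma block_in (t : idx X) :
  [set u | (if u \in A then Some u else None)
           == (if t \in A then Some t else None)] \in singletons_partition.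
Proof.
apply/imsetP; exists t; rewrite ?inE //.
by apply/setP => u; rewrite !inE eq_sym.
Qed.

Lemma singleton_in t : t \in A -> [set t] \in singletons_partition.
Proof.
move=> tA; suff -> : [set t] = [set u | (if u \in A then Some u else None)
           == (if t \in A then Some t else None)] by exact: block_in.
apply/setP => u.
rewrite !inE tA; case: ifP => // uA.
by apply: negbTE; apply: contraFneq uA => ->.
Qed.

Hypothesis X_fusion : forall (P : {set {set idx X}}) (eP : [set eidx X] \in P),
  partition P [set: idx X] -> is_calgebra (fusion eP).

Let F := X_fusion (singleton_in eA) singletons_partitionP.

Lemma singleton_space r : r \in A ->
  bas r \in <<codom (@fusion_bas R X singletons_partition)>>%VS.
Proof.
move=> rA.
rewrite (_ : bas r = fusion_bas (exist _ [set r] (singleton_in rA))).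
  exact/memv_span/codom_f.
by rewrite /fusion_bas big_set1.
Qed.

Lemma fusion_coef_eq t t' v : t \notin A -> t' \notin A ->
  v \in <<codom (@fusion_bas R X singletons_partition)>>%VS ->
  coef t v = coef t' v.
Proof.
move=> tA t'A; have /and3P[_ tP _] := singletons_partitionP.
apply: (fusion_coef_const tP (block_in t)); rewrite inE ?eqxx //.
by rewrite (negPf tA) (negPf t'A).
Qed.

Lemma amorphic_const r s t t' : r \in A -> s \in A -> t \notin A ->
  t' \notin A -> rconst r s t = rconst r s t'.
Proof.
move=> rA sA tA t'A; rewrite /rconst /struct_const (fusion_coef_eq tA t'A) //.
exact: (calg_mul F (singleton_space rA) (singleton_space sA)).
Qed.

Lemma amorphic_star_coef r t t' : r \in A -> t \notin A -> t' \notin A ->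
  coef t (star (bas r)) = coef t' (star (bas r)).
Proof.
move=> rA tA t'A; apply: fusion_coef_eq => //.
exact: (calg_star F (singleton_space rA)).
Qed.

End Fusion.

(** * The structure constants of an amorphic algebra *)

Section Amorphic.
Variables (R : realType) (X : calg_data R).
Hypothesis X_amorphic : amorphic X.
Hypothesis X_nontrivial : (4 <= #|idx X|)%N.

Let X_calg := X_amorphic.1.
Let e := eidx X.

(** If the involution sent r to some s different from e and r, then, in the
fusion keeping only e and r separate, s would have to occur with the same
coefficient as any other merged element; there is one, as the rank is at
least 4. *)
Lemma amorphic_star r : star (bas r) = bas r :> ambient X.
Proof.
have [s star_r] := calg_C1_star X_calg r; rewrite star_r.
have [se|sn] := eqVneq s e.
  rewrite -star_r -[bas r in RHS](calg_starK X_calg (bas_space X_calg r)).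
  by rewrite star_r se (calg_C1_unit X_calg) star1.
have [-> //|sr] := eqVneq s r.
have [|t] := @exists_notin _ [:: e; r; s]; first exact: X_nontrivial.
rewrite !inE !negb_or => /and3P[te tr ts].
have eA : e \in [set e; r] by rewrite !inE eqxx.
have rA : r \in [set e; r] by rewrite !inE eqxx orbT.
have sA : s \notin [set e; r] by rewrite !inE negb_or sn.
have tA : t \notin [set e; r] by rewrite !inE negb_or te.
have := amorphic_star_coef X_calg eA X_amorphic.2 rA sA tA.
rewrite star_r !coef_bas // eqxx eq_sym (negPf ts) => /eqP.
by rewrite oner_eq0.
Qed.

Let c : idx X -> idx X -> idx X -> R := @rconst R X.

(** The involution reverses products and fixes real combinations of the
basis. *)
Lemma bas_comm (r s : idx X) : bas r * bas s = bas s * bas r.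
Proof.
have <- : star (bas r * bas s) = bas r * bas s.
  rewrite bas_mul // star_sum // => [|t]; last exact: bas_space.
  apply: eq_bigr => t _.
  by rewrite amorphic_star (conjc_real _ : ((_%:C)^*)%R = _).
by rewrite (calg_star_anti X_calg) ?bas_space // !amorphic_star.
Qed.

Lemma rconst_comm r s t : c r s t = c s r t.
Proof. by rewrite /c /rconst /struct_const bas_comm. Qed.

Lemma rconst_assoc r s t v :
  \sum_u c r s u * c u t v = \sum_u c s t u * c r u v.
Proof.
have := mulrA (bas r) (bas s) (bas t); rewrite !bas_mul //.
rewrite mulr_sumr mulr_suml => /(congr1 (coef v)).
rewrite !coef_big => eqC.
have inj : injective (real_complex R) := @fmorph_inj _ _ _.
apply: inj; rewrite !rmorph_sum.
transitivity (\sum_u coef v ((c r s u)%:C *: bas u * bas t)).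
  apply: eq_bigr => u _; rewrite rmorphM -scalerAl coefZ.
  by rewrite -[coef v (_ * _)]/(struct_const u t v) struct_constE.
rewrite -eqC; apply: eq_bigr => u _; rewrite rmorphM -scalerAr coefZ.
by rewrite -[coef v (_ * _)]/(struct_const r u v) struct_constE.
Qed.

Lemma rconst_unit r t : c e r t = (r == t)%:R.
Proof.
rewrite /c /rconst /struct_const (calg_C1_unit X_calg) mul1r coef_bas //.
by case: (r == t).
Qed.

Lemma rconst_e r s : c r s e = deg r *+ (r == s).
Proof.
rewrite /c /rconst (calg_C3 X_calg) amorphic_star (inj_eq (bas_inj X_calg)).
by case: (r == s).
Qed.

(** Both sides are the coefficient of e in the triple product of r, s and t. *)
Lemma rconst_cyc r s t : deg t * c r s t = deg r * c s t r.
Proof.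
have := rconst_assoc r s t e.
rewrite (bigD1 t) //= big1 ?addr0 => [|u /negPf ut]; last first.
  by rewrite rconst_e ut mulr0.
rewrite (bigD1 r) //= big1 ?addr0 => [|u /negPf ur]; last first.
  by rewrite rconst_e eq_sym ur mulr0.
by rewrite !rconst_e !eqxx mulrC => ->; rewrite mulrC.
Qed.

Lemma deg_functional_bas (r : idx X) : deg_functional (bas r) = (deg r)%:C.
Proof.
rewrite /deg_functional (bigD1 r) //= coef_bas // eqxx mul1r.
rewrite big1 ?addr0 // => s.
by rewrite eq_sym => /negPf h; rewrite coef_bas // h mul0r.
Qed.

Lemma rconst_deg r s : \sum_t c r s t * deg t = deg r * deg s.
Proof.
have inj : injective (real_complex R) := @fmorph_inj _ _ _.
apply: inj; rewrite rmorphM rmorph_sum /= -!deg_functional_bas.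
rewrite -(calg_C4_mul X_calg) ?bas_space //.
apply: eq_bigr => t _; rewrite rmorphM.
by rewrite -[coef t (_ * _)]/(struct_const r s t) struct_constE.
Qed.

Lemma deg_eidx : deg e = 1.
Proof.
have inj : injective (real_complex R) := @fmorph_inj _ _ _.
apply: inj; rewrite -deg_functional_bas.
by rewrite (calg_C1_unit X_calg) (calg_C4_unit X_calg).
Qed.

Lemma rconst_const r s t t' : t \notin [:: e; r; s] ->
  t' \notin [:: e; r; s] -> c r s t = c r s t'.
Proof.
move=> tn t'n; have inE3 u : (u \in [set e; r; s]) = (u \in [:: e; r; s]).
  by rewrite !inE orbA.
have eA : e \in [set e; r; s] by rewrite !inE eqxx.
by apply: (amorphic_const X_calg eA X_amorphic.2);
  rewrite ?inE3 // !inE eqxx ?orbT.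
Qed.

Theorem amorphic_classification :
  exists (eps x : R), [/\ eps = 1 \/ eps = -1, 0 < x,
    \sum_(r | r != e) deg r / x = x - 2 * eps
    & forall r s t : idx X, struct_const r s t =
        (scaled_const e eps x (fun r => deg r / x) r s t)%:C].
Proof.
have [eps [x [eps_pm x_gt0 sum_k cE]]] := forced_constants X_nontrivial
  (calg_C3_pos X_calg) deg_eidx rconst_unit rconst_e rconst_comm rconst_cyc
  rconst_deg rconst_assoc rconst_const.
by exists eps, x; split=> // r s t; rewrite struct_constE // -cE.
Qed.

End Amorphic.

(** * Diagonal matrices as functions on a finite set *)

Section FunDiag.
Variables (K : numClosedFieldType) (J : finType) (e : J).

(** The size of the matrix is #|J|, written as a successor so that the matrices
form a nontrivial ring; e is the default value of the enumeration. *)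
Definition fun_diag (f : J -> K) : 'M[K]_(#|J|.-1.+1) :=
  diag_mx (\row_i f (nth e (enum J) i)).

Definition adjoint (n : nat) (M : 'M[K]_n) : 'M[K]_n := map_mx Num.conj M^T.

Lemma fun_diag_inj f g : fun_diag f = fun_diag g -> f =1 g.
Proof.
move=> eq_fg j; have lt_j : (index j (enum J) < #|J|.-1.+1)%N.
  rewrite prednK ?cardE ?index_mem ?mem_enum // -cardE.
  by apply/card_gt0P; exists e.
have := congr1 (fun M : 'M_ _ => M (Ordinal lt_j) (Ordinal lt_j)) eq_fg.
by rewrite !mxE eqxx !mulr1n /= nth_index ?mem_enum.
Qed.

Lemma eq_fun_diag f g : f =1 g -> fun_diag f = fun_diag g.
Proof. by move=> fg; congr diag_mx; apply/rowP => i; rewrite !mxE fg. Qed.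

Lemma fun_diagM f g : fun_diag f * fun_diag g = fun_diag (fun j => f j * g j).
Proof.
apply/matrixP => i j; rewrite -[_ * _]/(_ *m _) mul_diag_mx !mxE.
by rewrite -mulrnAr; case: eqP => [->|]; rewrite ?mulr1n ?mulr0n.
Qed.

Lemma fun_diag1 : fun_diag (fun=> 1) = 1.
Proof. by apply/matrixP => i j; rewrite !mxE. Qed.

Lemma fun_diag_sum (I : finType) (P : pred I) (a : I -> K) (f : I -> J -> K) :
  \sum_(i | P i) a i *: fun_diag (f i) =
  fun_diag (fun j => \sum_(i | P i) a i * f i j).
Proof.
apply/matrixP => u v; rewrite summxE !mxE.
rewrite -sumrMnl; apply: eq_bigr => i _; by rewrite !mxE mulrnAr.
Qed.

Lemma adjoint_fun_diag f :
  adjoint (fun_diag f) = fun_diag (fun j => ((f j)^*)%R).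
Proof.
by apply/matrixP => i j; rewrite !mxE eq_sym rmorphMn; case: eqP => [->|].
Qed.

Lemma adjointK n : involutive (@adjoint n).
Proof. by move=> M; apply/matrixP => i j; rewrite !mxE conjCK. Qed.

Lemma adjointM n (M M' : 'M[K]_n) : adjoint (M *m M') = adjoint M' *m adjoint M.
Proof. by rewrite /adjoint trmx_mul map_mxM. Qed.

Lemma adjoint_semilinear n a (M M' : 'M[K]_n) :
  adjoint (a *: M + M') = (a^*)%R *: adjoint M + adjoint M'.
Proof. by apply/matrixP => i j; rewrite !mxE rmorphD rmorphM. Qed.

End FunDiag.

(** * The generalized affine algebra *)

Section AffineModel.
Variables (R : realType) (J : finType) (e : J) (eps x : R).
Hypothesis eps_pm : eps = 1 \/ eps = -1.
Hypothesis x_gt0 : 0 < x.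
Hypothesis card_J : (4 <= #|J|)%N.
Hypothesis sum_1 : \sum_(r | r != e) 1 = x - 2 * eps.

Let eps2 : eps * eps = 1. Proof. by case: eps_pm => ->; ring. Qed.

Let chi (j r : J) : R := scaled_char e eps x (fun=> 1) j r.
Let c (r s t : J) : R := scaled_const e eps x (fun=> 1) r s t.

Let x_large : 3 <= x - 2 * eps.
Proof.
rewrite -sum_1 sumr_const (ler_nat _ 3).
by have := cardC1 e; rewrite -(@eq_card _ (fun r => r != e)) // => ->; lia.
Qed.

(** Comparing the characters of index e and j shows that a j is - eps S for all
j other than e, where S is the sum of these a j; adding up over j then
gives (eps x - 1) S = 0. *)
Lemma affine_char_indep (a : J -> R) :
  (forall j, \sum_r a r * chi j r = 0) -> forall r, a r = 0.
Proof.
move=> a0; set S := \sum_(r | r != e) a r.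
have Ee : a e + x * S = 0.
  rewrite -[RHS](a0 e) (bigD1 e) //= /chi /scaled_char eqxx !mulr1 /S mulr_sumr.
  by congr (_ + _); apply: eq_bigr => r /negPf->; rewrite mulrC.
have Ej j : j != e -> a e + eps * S + (1 - eps * x) * a j = 0.
  move=> jn; rewrite -[RHS](a0 j) (bigD1 e) //= /chi /scaled_char eqxx !mulr1.
  rewrite -addrA; congr (_ + _).
  rewrite -(sum_delta (P := fun r => r != e) (fun r => (1 - eps * x) * a r) jn).
  rewrite /S mulr_sumr -big_split /=.
  apply: eq_bigr => r /negPf->; rewrite (negPf jn).
  by case: (r == j); rewrite ?mulr1n ?mulr0n; ring.
have aE j : j != e -> a j = - eps * S.
  move=> jn; have := Ej j jn; have h : eps != x.
    by apply/eqP => xe; move: x_large x_gt0; case: eps_pm xe => -> <-; lra.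
  move=> E; apply: (mulfI (_ : eps * (eps - x) != 0)).
    rewrite mulf_neq0 ?subr_eq0 //.
    by case: eps_pm => ->; rewrite ?oppr_eq0 oner_eq0.
  by apply/eqP; rewrite -subr_eq0 -(subrr 0) -{1}E -Ee; apply/eqP; ring: eps2.
have S0 : S = 0.
  have : S = - eps * S * (x - 2 * eps).
    rewrite -sum_1 mulr_sumr /S; apply: eq_bigr => r rn.
    by rewrite mulr1 aE.
  move=> E; have {}E : (eps * x - 1) * S = 0.
    by apply/eqP; rewrite -(subrr S) {3}E; apply/eqP; ring: eps2.
  apply/eqP; move/eqP: E; rewrite mulf_eq0 => /orP[|//].
  by move: x_large x_gt0; case: eps_pm => -> h1 h2 /eqP h3; exfalso; lra.
move=> r; have [->|rn] := eqVneq r e; last by rewrite aE // S0 mulr0.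
by move: Ee; rewrite S0 mulr0 addr0.
Qed.

Definition affine_bas (r : J) : 'M[R[i]]_(#|J|.-1.+1) :=
  fun_diag e (fun j => (chi j r)%:C).

Definition affine_calg : calg_data R :=
  {| ambient := 'M[R[i]]_(#|J|.-1.+1);
     star := @adjoint _ _;
     Defs.space := <<codom_tuple affine_bas>>%VS;
     idx := J;
     bas := affine_bas;
     eidx := e |}.

(** The characters are real, so that a complex dependency splits into its real
and imaginary parts. *)
Lemma affine_free : free (codom_tuple affine_bas).
Proof.
apply: free_codomP => a; rewrite fun_diag_sum => a0.
have {}a0 : (fun j => \sum_r a r * (chi j r)%:C) =1 (fun=> 0).
  apply: (@fun_diag_inj _ _ e); rewrite a0.
  by apply/matrixP => u v; rewrite !mxE mul0rn.
have parts (p : {additive R[i] -> R}) :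
    (forall z (y : R), p (z * y%:C) = p z * y) -> forall r, p (a r) = 0.
  move=> pM; apply: affine_char_indep => j.
  rewrite -[RHS](raddf0 p) -(a0 j) raddf_sum.
  by apply: eq_bigr => r _; rewrite pM.
move=> r; apply/eqP; rewrite eq_complex /=; apply/andP; split; apply/eqP.
  by apply: (parts (@complex.Re R)) => -[u v] y /=; rewrite mulr0 subr0.
by apply: (parts (@complex.Im R)) => -[u v] y /=; rewrite mulr0 add0r.
Qed.

Lemma affine_basM r s :
  affine_bas r * affine_bas s = \sum_t (c r s t)%:C *: affine_bas t.
Proof.
rewrite fun_diagM fun_diag_sum; apply: eq_fun_diag => j.
rewrite -rmorphM (scaled_charM eps2 sum_1) rmorph_sum.
by apply: eq_bigr => t _; rewrite rmorphM.
Qed.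

Lemma affine_bas_e : affine_bas e = 1.
Proof.
rewrite -(fun_diag1 _ e); apply: eq_fun_diag => j.
by rewrite /chi /scaled_char eqxx.
Qed.

Lemma affine_star r : adjoint (affine_bas r) = affine_bas r.
Proof.
by rewrite adjoint_fun_diag; apply: eq_fun_diag => j; exact: conjc_real.
Qed.

Lemma affine_struct_const (r s t : idx affine_calg) :
  struct_const r s t = (c r s t)%:C.
Proof.
rewrite /struct_const /coef /= affine_basM.
by rewrite (coord_codom_sum (fun t => (c r s t)%:C)) //; exact: affine_free.
Qed.

Lemma affine_deg (r : idx affine_calg) : deg r = if r == e then 1 else x.
Proof.
rewrite /deg [star _]affine_star -[coef _ _]/(struct_const r r e).
rewrite affine_struct_const /c /scaled_const /= !eqxx mulr1.
by case: (r == e).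
Qed.

Lemma affine_expand (v : ambient affine_calg) : v \in Defs.space affine_calg ->
  v = \sum_r coef r v *: affine_bas r.
Proof. exact: coord_codom_span. Qed.

Lemma affine_bas_in r : affine_bas r \in Defs.space affine_calg.
Proof. by rewrite memv_span ?codom_f. Qed.

(** The character of index e is the degree functional; being an entry of a
diagonal matrix, it is multiplicative. *)
Lemma affine_diag (v : ambient affine_calg) : v \in Defs.space affine_calg ->
  exists2 f, v = fun_diag e f & f e = deg_functional v.
Proof.
move=> v_in; exists (fun j => \sum_r coef r v * (chi j r)%:C).
  by rewrite {1}(affine_expand v_in) fun_diag_sum.
apply: eq_bigr => r _; rewrite affine_deg /chi /scaled_char eqxx mulr1.
by case: ifP.
Qed.

Lemma affine_calgP : is_calgebra affine_calg.
Proof.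
have one_in : 1 \in Defs.space affine_calg.
  by rewrite -affine_bas_e affine_bas_in.
have mul_in : {in Defs.space affine_calg &,
    forall u v, u * v \in Defs.space affine_calg}.
  move=> u v /affine_expand-> /affine_expand->.
  rewrite mulr_suml memv_suml // => r _; rewrite mulr_sumr memv_suml // => s _.
  rewrite -scalerAl -scalerAr !memvZ // affine_basM memv_suml // => t _.
  by rewrite memvZ ?affine_bas_in.
have star_in : {in Defs.space affine_calg,
    forall u, adjoint u \in Defs.space affine_calg}.
  move=> u /affine_expand->.
  rewrite (_ : adjoint _ = \sum_r ((coef r u)^*)%R *: affine_bas r).
    by rewrite memv_suml // => r _; rewrite memvZ ?affine_bas_in.
  rewrite !fun_diag_sum adjoint_fun_diag; apply: eq_fun_diag => j.
  rewrite rmorph_sum; apply: eq_bigr => r _; rewrite rmorphM; congr (_ * _).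
  exact: conjc_real.
split=> //.
- by move=> a u v _ _; exact: adjoint_semilinear.
- by move=> u _; exact: adjointK.
- by move=> u v _ _; exact: adjointM.
- by rewrite /basis_of eqxx affine_free.
- exact: affine_bas_e.
- by move=> r; exists r; exact: affine_star.
- move=> r s t; apply/complex_realP; exists (c r s t).
  exact: affine_struct_const.
- by move=> r; rewrite affine_deg; case: ifP.
- move=> r s; rewrite affine_struct_const affine_deg [star _]affine_star.
  rewrite (inj_eq (free_codom_inj affine_free)) /c /scaled_const eqxx mulr1.
  have [->|rn] := eqVneq r e; first by rewrite eq_sym; case: eqP.
  have [->|sn] := eqVneq s e; first by rewrite (negPf rn).
  by case: (r == s).
- have [f f1 <-] := affine_diag one_in.
  by rewrite -(fun_diag_inj (etrans (fun_diag1 _ e) f1)).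
- move=> u v u_in v_in.
  have [f uE <-] := affine_diag u_in; have [g vE <-] := affine_diag v_in.
  have [h uvE <-] := affine_diag (mul_in u v u_in v_in).
  have : fun_diag e (fun j => f j * g j) = fun_diag e h.
    by rewrite -uvE uE vE fun_diagM.
  by move/fun_diag_inj <-.
- move=> u u_in; have [f uE <-] := affine_diag u_in.
  have [h suE <-] := affine_diag (star_in u u_in).
  have suE' : fun_diag e h = fun_diag e (fun j => ((f j)^*)%R).
    by rewrite -suE -adjoint_fun_diag -uE.
  by rewrite (fun_diag_inj suE').
Qed.

Theorem affine_calg_generalized_affine : generalized_affine affine_calg.
Proof.
split; first exact: affine_calgP.
  by move=> r s rn sn; rewrite !affine_deg (negPf rn) (negPf sn).
pose d (r : J) : R := if r == e then 1 else x * 1.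
have one_gt0 (r : J) : 0 < 1 :> R by [].
exists eps, (codom d); split=> //.
- split; first by rewrite size_codom.
    by apply/allP => _ /codomP[r ->]; rewrite /d mulr1; case: ifP.
  by apply/codomP; exists e; rewrite /d eqxx.
- split; first exact: affine_calgP.
  exists d; split=> //; first by rewrite /d eqxx.
    exact: affine_star.
  move=> r s t; rewrite affine_struct_const.
  by rewrite (Aeps_const_scaled eps_pm x_gt0 one_gt0 sum_1).
move=> r /negPf rn; rewrite affine_deg rn.
rewrite -[LHS](sqrt_total_scaled eps_pm x_gt0 one_gt0 sum_1).
congr (Num.sqrt _ + _).
by apply: eq_bigr => s _; rewrite affine_deg mulr1.
Qed.

End AffineModel.

(** * Integral multiplicities *)

(** For r, s, t distinct and different from e, the constants with indices
r, s, s and r, s, t differ by eps k_r.  The predecessor of k_r is recorded, to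
make all fibres below nonempty; the fibre of e is to be a singleton. *)
Lemma integral_multiplicities (R : realType) (I : finType) (e : I) (eps x : R)
    (k : I -> R) :
  eps = 1 \/ eps = -1 -> (4 <= #|I|)%N -> (forall r, 0 < k r) ->
  (forall r s t, exists z : int, (scaled_const e eps x k r s t)%:C = z%:~R) ->
  exists p : I -> nat, p e = 0%N /\ forall r, r != e -> k r = (p r).+1%:R.
Proof.
move=> eps_pm card_I k_gt0 k_int.
have kP r : exists p : nat, if r == e then p = 0%N else k r = p.+1%:R.
  have [_|rn] := eqVneq r e; first by exists 0%N.
  have [|s] := @exists_notin I [:: e; r]; first exact: leq_trans card_I.
  rewrite !inE !negb_or => /andP[sn sr].
  have [|t] := @exists_notin I [:: e; r; s]; first exact: card_I.
  rewrite !inE !negb_or => /and3P[tn tr ts].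
  have rs : r != s by rewrite eq_sym.
  have [z1 Ez1] := k_int r s t; have [z2 Ez2] := k_int r s s.
  have int_inj (y : R) (z : int) : y%:C = z%:~R -> y = z%:~R.
    by rewrite -(rmorph_int (real_complex R)) => /fmorph_inj.
  move: Ez1 Ez2 => /int_inj + /int_inj.
  rewrite /scaled_const (negPf rn) (negPf sn) (negPf tn) (negPf tr) (negPf ts).
  rewrite (negPf sr) (negPf rs) eqxx /= ?mulr1n ?mulr0n => E1 E2.
  have [z kz] : exists z : int, k r = z%:~R.
    (* The first factor is eps, which is its own inverse. *)
    exists ((if eps == 1 then 1 else -1) * (z2 - z1)).
    rewrite rmorphM rmorphB /= -E1 -E2; case: eps_pm => ->.
      by rewrite eqxx; ring.
    rewrite eqr_oppLR -subr_eq0 opprK (_ : 1 + 1 = 2%:R :> R) // pnatr_eq0 /=.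
    by rewrite rmorphN; ring.
  have := k_gt0 r; rewrite kz ltr0z.
  by case: z {kz} => [[|p]|p] // _; exists p.
have [p pP] := fin_all_exists kP; exists p; split.
  by have := pP e; rewrite eqxx.
by move=> r /negPf rn; have := pP r; rewrite rn.
Qed.

(** * Splitting each basis element into its multiplicity *)

Section AffineCover.
Variables (R : realType) (X : calg_data R) (eps x : R) (p : idx X -> nat).
Let e := eidx X.
Let k (r : idx X) : R := deg r / x.

Hypothesis X_calg : is_calgebra X.
Hypothesis X_star : forall r, star (bas r) = bas r :> ambient X.
Hypothesis X_nontrivial : (4 <= #|idx X|)%N.
Hypothesis eps_pm : eps = 1 \/ eps = -1.
Hypothesis x_gt0 : 0 < x.
Hypothesis sum_k : \sum_(r | r != e) k r = x - 2 * eps.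
Hypothesis X_const : forall r s t : idx X,
  struct_const r s t = (scaled_const e eps x k r s t)%:C.
Hypothesis p_e : p e = 0%N.
Hypothesis k_nat : forall r, r != e -> k r = (p r).+1%:R.

Definition split_idx : finType := {r : idx X & 'I_(p r).+1}.
Definition split_first (r : idx X) : split_idx :=
  Tagged (fun r => 'I_(p r).+1) (ord0 : 'I_(p r).+1).
Definition split_e : split_idx := split_first e.

Lemma split_eP (j : split_idx) : (j == split_e) = (tag j == e).
Proof.
apply/eqP/eqP => [-> //|]; case: j => r i /= re; move: i; rewrite re => i.
congr existT; apply/val_inj => /=.
by case: i => m /=; rewrite p_e ltnS leqn0 => /eqP.
Qed.

Lemma sum_split (F : idx X -> R) (P : pred (idx X)) :
  \sum_(j : split_idx | P (tag j)) F (tag j) = \sum_(r | P r) F r *+ (p r).+1.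
Proof.
rewrite (eq_bigr (fun r => \sum_(i < (p r).+1) F r)).
  rewrite (sig_big_dep _ (fun _ => xpredT) (fun r i => F r)).
  by apply: eq_bigl => j; rewrite andbT.
by move=> r _; rewrite sumr_const card_ord.
Qed.

Lemma sum_split1 : \sum_(j : split_idx | j != split_e) 1 = x - 2 * eps.
Proof.
rewrite -sum_k (eq_bigl (fun j => tag j != e)); last first.
  by move=> j; rewrite split_eP.
rewrite (sum_split (fun=> 1) (fun r => r != e)).
by apply: eq_bigr => r /k_nat->.
Qed.

Lemma card_split : (4 <= #|split_idx|)%N.
Proof.
apply: leq_trans X_nontrivial _.
by apply: (@leq_card _ _ split_first) => r s /(congr1 tag).
Qed.

Definition affine_cover : calg_data R := affine_calg split_e eps x.
Definition fibre (r : idx X) : {set idx affine_cover} :=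
  [set j : split_idx | tag j == r].
Definition fibres : {set {set idx affine_cover}} :=
  preim_partition (fun j : split_idx => tag j) [set: split_idx].

Lemma fibre_in r : fibre r \in fibres.
Proof.
apply/imsetP; exists (split_first r); first by rewrite inE.
by apply/setP => j; rewrite !inE eq_sym.
Qed.

Lemma in_fibres (B : {set idx affine_cover}) :
  B \in fibres -> exists r, B = fibre r.
Proof.
move=> /imsetP[j _ ->]; exists (tag j).
by apply/setP => u; rewrite !inE eq_sym.
Qed.

Lemma fibre_e : fibre e = [set eidx affine_cover].
Proof. by apply/setP => j; rewrite !inE -split_eP. Qed.

Lemma fibres_e : [set eidx affine_cover] \in fibres.
Proof. by rewrite -fibre_e fibre_in. Qed.

Let chi (i r : idx X) : R := scaled_char e eps x k i r.

Definition fibre_sum (r : idx X) : ambient affine_cover :=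
  \sum_(j in fibre r) bas j.

(** Adding the values eps + (1 - eps x) [i = j] over the fibre of r gives
eps k_r + (1 - eps x) if j lies in that fibre and eps k_r otherwise, so the
fibre sums have the character table of the original algebra. *)
Lemma fibre_sumE r :
  fibre_sum r = fun_diag split_e (fun j => (chi (tag j) r)%:C).
Proof.
rewrite /fibre_sum (eq_bigr (fun j => 1 *: bas j)); last first.
  by move=> j _; rewrite scale1r.
rewrite fun_diag_sum; apply: eq_fun_diag => j.
under eq_bigr => i _ do rewrite mul1r.
rewrite -rmorph_sum; congr (_%:C); rewrite /chi /scaled_char -split_eP.
have [->|rn] := eqVneq r e.
  by rewrite fibre_e big_set1 eqxx.
have k_sum (y : R) : \sum_(i in fibre r) y = y * k r.
  rewrite (eq_bigl (fun i : split_idx => tag i == r)); last first.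
    by move=> i; rewrite inE.
  by rewrite (sum_split (fun=> y) (pred1 r)) big_pred1_eq k_nat // mulr_natr.
have in_e i : i \in fibre r -> (i == split_e) = false.
  by rewrite inE split_eP => /eqP->; apply/negbTE.
have [_|jn] := eqVneq j split_e.
  rewrite -k_sum; apply: eq_bigr => i /in_e->; exact: mulr1.
rewrite (eq_bigr (fun i => eps + (1 - eps * x) *+ (i == j))); last first.
  by move=> i /in_e->; rewrite mulr1.
rewrite big_split /= k_sum; congr (_ + _).
have [rj|rj] := eqVneq r (tag j).
  by rewrite (@sum_delta R _ _ (fun=> 1 - eps * x) j) // inE rj.
rewrite big1 // => i; rewrite inE; case: (eqVneq i j) => // -> /eqP tj.
by rewrite tj eqxx in rj.
Qed.

Let eps2 : eps * eps = 1. Proof. by case: eps_pm => ->; ring. Qed.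

Lemma fibre_sumM r s :
  fibre_sum r * fibre_sum s = \sum_t struct_const r s t *: fibre_sum t.
Proof.
rewrite !fibre_sumE fun_diagM.
under eq_bigr => t _ do rewrite fibre_sumE.
rewrite fun_diag_sum; apply: eq_fun_diag => j.
rewrite -rmorphM (scaled_charM eps2 sum_k) rmorph_sum.
by apply: eq_bigr => t _; rewrite rmorphM X_const.
Qed.

Lemma fibre_sum_e : fibre_sum e = 1.
Proof. by rewrite /fibre_sum fibre_e big_set1 [bas _]affine_bas_e. Qed.

Lemma fibre_sum_star r : star (fibre_sum r) = fibre_sum r.
Proof.
rewrite fibre_sumE [star _]adjoint_fun_diag.
by apply: eq_fun_diag => j; exact: conjc_real.
Qed.

(** The fibres are nonempty and disjoint, so a dependency between the fibre sums
is one between the elements of a free family. *)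
Lemma fibre_sum_indep (a : idx X -> R[i]) :
  \sum_r a r *: fibre_sum r = 0 -> forall r, a r = 0.
Proof.
move=> a0 r; have free_b := affine_free eps_pm x_gt0 card_split sum_split1.
rewrite -[a r]/(a (tag (split_first r))).
rewrite -(coord_codom_sum (fun j : split_idx => a (tag j)) _ free_b).
suff -> : \sum_(i : split_idx) a (tag i) *: affine_bas split_e eps x i = 0.
  exact: linear0.
rewrite -[RHS]a0 (partition_big (fun i : split_idx => tag i) xpredT) //=.
apply: eq_bigr => s _; rewrite scaler_sumr; apply: eq_big => i; rewrite ?inE //.
by move=> /eqP->.
Qed.

Definition cover_fun (v : ambient X) : ambient affine_cover :=
  \sum_r coef r v *: fibre_sum r.

Lemma cover_fun_linear : linear cover_fun.
Proof.
move=> a u v; rewrite /cover_fun scaler_sumr -big_split /=.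
by apply: eq_bigr => r _; rewrite coefD coefZ scalerDl scalerA.
Qed.

HB.instance Definition _ := GRing.isLinear.Build _ _ _ _
  cover_fun cover_fun_linear.

Lemma cover_fun_bas r : cover_fun (bas r) = fibre_sum r.
Proof.
rewrite /cover_fun (bigD1 r) //= coef_bas // eqxx scale1r big1 ?addr0 // => s.
by rewrite eq_sym => /negPf h; rewrite coef_bas // h scale0r.
Qed.

Lemma cover_funM u v : u \in Defs.space X -> v \in Defs.space X ->
  cover_fun (u * v) = cover_fun u * cover_fun v.
Proof.
move=> u_in v_in.
rewrite {1}(coef_expand X_calg u_in) {1}(coef_expand X_calg v_in).
rewrite mulr_suml linear_sum [in RHS]mulr_suml; apply: eq_bigr => r _.
rewrite mulr_sumr linear_sum [in RHS]mulr_sumr; apply: eq_bigr => s _.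
rewrite -!scalerAl -!scalerAr !linearZ /= [RHS]scalerA [coef s v * _]mulrC.
rewrite -[RHS]scalerA; do 2!congr (_ *: _).
rewrite fibre_sumM; rewrite /cover_fun.
by apply: eq_bigr.
Qed.

Lemma cover_fun_star u : u \in Defs.space X ->
  cover_fun (star u) = star (cover_fun u).
Proof.
move=> u_in; rewrite {1}(coef_expand X_calg u_in) (star_sum X_calg); last first.
  exact: bas_space.
have Y_calg : is_calgebra affine_cover.
  exact: affine_calgP eps_pm x_gt0 card_split sum_split1.
transitivity (\sum_r ((coef r u)^*)%R *: fibre_sum r).
  by rewrite linear_sum; apply: eq_bigr => r _;
    rewrite linearZ /= X_star cover_fun_bas.
rewrite (star_sum Y_calg) => [|r].
  by apply: eq_bigr => r _; rewrite fibre_sum_star.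
by rewrite memv_suml // => j _; exact: bas_space.
Qed.

Lemma cover_iso : calg_isomorphic X (fusion fibres_e).
Proof.
exists (linfun cover_fun).
have codomE : codom (fun r => linfun cover_fun (bas r))
    =i codom (@bas R (fusion fibres_e)).
  move=> y; apply/codomP/codomP => [[r ->]|[[B BP] ->]].
    exists (exist _ (fibre r) (fibre_in r)).
    by rewrite lfunE /= cover_fun_bas.
  have [r Br] := in_fibres BP; exists r.
  by rewrite lfunE /= cover_fun_bas /fusion_bas /= Br.
split=> //.
- split.
    move=> u v u_in v_in; rewrite !lfunE /= => /eqP; rewrite -subr_eq0.
    rewrite -linearB => /eqP /fibre_sum_indep uv0.
    apply/eqP; rewrite -subr_eq0.
    have uv_in : u - v \in Defs.space X by rewrite memvB.
    rewrite (coef_expand X_calg uv_in) big1 // => r _.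
    by rewrite uv0 scale0r.
  rewrite (space_span X_calg) limg_span; apply: eq_span => y.
  by rewrite -codomE /codom /image_mem -map_comp.
- by rewrite lfunE /= -(calg_C1_unit X_calg) cover_fun_bas fibre_sum_e.
- by move=> u v u_in v_in; rewrite !lfunE /= cover_funM.
- by move=> u u_in; rewrite !lfunE /= cover_fun_star.
Qed.

End AffineCover.

Theorem corollary4p2 (R : realType) (X : calg_data R)
    (X_amorphic : amorphic X)
    (X_nontrivial : (4 <= #|idx X|)%N)
    (X_integral : integral_constants X) :
  exists Y : calg_data R,
    generalized_affine Y /\
    exists (P : {set {set idx Y}}) (eP : [set eidx Y] \in P),
      partition P [set: idx Y] /\ calg_isomorphic X (fusion eP).
Proof.
have [eps [x [eps_pm x_gt0 sum_k cE]]] :=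
  amorphic_classification X_amorphic X_nontrivial.
have k_gt0 (r : idx X) : 0 < deg r / x.
  by rewrite divr_gt0 ?(calg_C3_pos X_amorphic.1).
have k_int (r s t : idx X) : exists z : int, (scaled_const (eidx X) eps x
    (fun r => deg r / x) r s t)%:C = z%:~R.
  by have [z zE] := X_integral r s t; exists z; rewrite -cE zE.
have [p [p_e k_nat]] :=
  integral_multiplicities eps_pm X_nontrivial k_gt0 k_int.
exists (affine_cover eps x p); split.
  apply: affine_calg_generalized_affine => //.
    exact: card_split.
  exact: (sum_split1 sum_k p_e k_nat).
exists (fibres eps x p), (fibres_e eps x p_e); split.
  exact: preim_partitionP.
exact: (cover_iso X_amorphic.1 (amorphic_star X_amorphic X_nontrivial)).
Qed.
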